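(* Let $\mathcal{T}$ be a triangulated category. For silting subcategories $\mathcal{M},\mathcal{N}$ of $\mathcal{T}$ write $\mathcal{M}\ge\mathcal{N}$ if $\mathrm{Hom}_{\mathcal{T}}(M,N[i])=0$ for all $M\in\mathcal{M}$, $N\in\mathcal{N}$ and all $i>0$. Then $\ge$ is a partial order on the collection $\mathrm{silt}\,\mathcal{T}$ of silting subcategories of $\mathcal{T}$.
   Context: A ''subcategory'' of $\mathcal{T}$ always means a full subcategory closed under isomorphisms, finite coproducts and direct summands. $\mathrm{thick}\,\mathcal{M}$ is the smallest thick subcategory of $\mathcal{T}$ containing $\mathcal{M}$. A subcategory $\mathcal{M}$ of $\mathcal{T}$ is silting if $\mathrm{Hom}_{\mathcal{T}}(M,M'[i])=0$ for all $M,M'\in\mathcal{M}$ and $i>0$, and $\mathcal{T}=\mathrm{thick}\,\mathcal{M}$. $\mathrm{silt}\,\mathcal{T}$ denotes the collection of silting subcategories. *)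

(* Defs.v *)
(* Triangulated categories and silting subcategories (MathComp, with sets as
   Prop-valued predicates from mathcomp-classical). *)
From Stdlib Require Export Relation_Definitions.
From mathcomp Require Export all_boot all_algebra.
From mathcomp Require Export classical_sets.

Set Implicit Arguments.
Unset Strict Implicit.
Unset Printing Implicit Defensive.

Import GRing.Theory.
Local Open Scope ring_scope.

Reserved Notation "g \oc f" (at level 40, left associativity).

Record preadditive_category := PreadditiveCategory {
  ob :> Type;
  hom : ob -> ob -> zmodType;
  idm : forall X, hom X X;
  mcomp : forall X Y Z, hom Y Z -> hom X Y -> hom X Z
    where "g \oc f" := (mcomp g f);
  comp_idl : forall X Y (f : hom X Y), idm Y \oc f = f;
  comp_idr : forall X Y (f : hom X Y), f \oc idm X = f;
  compA : forall W X Y Z (h : hom Y Z) (g : hom X Y) (f : hom W X),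
    h \oc (g \oc f) = (h \oc g) \oc f;
  compDl : forall X Y Z (g g' : hom Y Z) (f : hom X Y),
    (g + g') \oc f = g \oc f + g' \oc f;
  compDr : forall X Y Z (g : hom Y Z) (f f' : hom X Y),
    g \oc (f + f') = g \oc f + g \oc f' }.

Arguments hom {_} _ _.
Arguments idm {_} _.

Notation "g \oc f" := (mcomp g f).

Definition is_iso (A : preadditive_category) (X Y : A) (f : hom X Y) : Prop :=
  exists g : hom Y X, g \oc f = idm X /\ f \oc g = idm Y.

Definition isomorphic (A : preadditive_category) (X Y : A) : Prop :=
  exists f : hom X Y, is_iso f.

(* Hom-sets are never empty, so this says that Z is initial and terminal. *)
Definition is_zero (A : preadditive_category) (Z : A) : Prop :=
  (forall X (f : hom Z X), f = 0) /\ (forall X (f : hom X Z), f = 0).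

Definition is_coproduct (A : preadditive_category) (X Y C : A)
    (i : hom X C) (j : hom Y C) : Prop :=
  forall W (f : hom X W) (g : hom Y W),
    exists! h : hom C W, h \oc i = f /\ h \oc j = g.

(* Finite coproducts are given by the empty one and the binary ones. *)
Record additive_category := AdditiveCategory {
  add_preadd :> preadditive_category;
  has_zero : exists Z : add_preadd, is_zero Z;
  has_coproducts : forall X Y : add_preadd,
    exists (C : add_preadd) (i : hom X C) (j : hom Y C), is_coproduct i j }.

Record additive_functor (A B : preadditive_category) := AdditiveFunctor {
  fob :> A -> B;
  fmap : forall X Y, hom X Y -> hom (fob X) (fob Y);
  fmap_id : forall X, fmap (idm X) = idm (fob X);
  fmap_comp : forall X Y Z (g : hom Y Z) (f : hom X Y),
    fmap (g \oc f) = fmap g \oc fmap f;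
  fmapD : forall X Y (f g : hom X Y), fmap (f + g) = fmap f + fmap g }.

Definition functor_id (A : preadditive_category) : additive_functor A A.
Proof. by exists id (fun X Y f => f). Defined.

Definition functor_comp (A B C : preadditive_category)
  (G : additive_functor B C) (F : additive_functor A B) : additive_functor A C.
Proof.
exists (fun X => G (F X)) (fun X Y f => fmap G (fmap F f)).
- by move=> X; rewrite !fmap_id.
- by move=> X Y Z g f; rewrite !fmap_comp.
- by move=> X Y f g; rewrite !fmapD.
Defined.

Record natural_iso (A B : preadditive_category) (F G : additive_functor A B) :=
  NaturalIso {
    component :> forall X, hom (F X) (G X);
    component_nat : forall X Y (f : hom X Y),
      component Y \oc fmap F f = fmap G f \oc component X;
    component_iso : forall X, is_iso (component X) }.

(* The shift [1] is an autoequivalence, not assumed to be bijective on objects;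
   [unshift] is a quasi-inverse [-1]. *)
Record shifted_category := ShiftedCategory {
  shifted_add :> additive_category;
  shift : additive_functor shifted_add shifted_add;
  unshift : additive_functor shifted_add shifted_add;
  shift_unit : natural_iso (functor_id shifted_add) (functor_comp unshift shift);
  shift_counit :
    natural_iso (functor_comp shift unshift) (functor_id shifted_add) }.

Arguments shift {_}.
Arguments unshift {_}.

(* [dist f g h] says that X -f-> Y -g-> Z -h-> X[1] is a distinguished
   triangle. *)
Record triangulated_category := TriangulatedCategory {
  tri_shifted :> shifted_category;
  dist : forall X Y Z : tri_shifted,
    hom X Y -> hom Y Z -> hom Z (shift X) -> Prop;
  (* TR1 *)
  dist_iso : forall (X Y Z X' Y' Z' : tri_shifted)
      (f : hom X Y) (g : hom Y Z) (h : hom Z (shift X))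
      (f' : hom X' Y') (g' : hom Y' Z') (h' : hom Z' (shift X'))
      (a : hom X X') (b : hom Y Y') (c : hom Z Z'),
    is_iso a -> is_iso b -> is_iso c ->
    b \oc f = f' \oc a -> c \oc g = g' \oc b ->
    fmap shift a \oc h = h' \oc c ->
    dist f g h -> dist f' g' h';
  dist_id : forall X Z : tri_shifted, is_zero Z ->
    dist (idm X) (0 : hom X Z) (0 : hom Z (shift X));
  dist_ex : forall (X Y : tri_shifted) (f : hom X Y),
    exists (Z : tri_shifted) (g : hom Y Z) (h : hom Z (shift X)), dist f g h;
  (* TR2 *)
  dist_rot : forall (X Y Z : tri_shifted)
      (f : hom X Y) (g : hom Y Z) (h : hom Z (shift X)),
    dist f g h <-> dist g h (- fmap shift f);
  (* TR3 *)
  dist_mor : forall (X Y Z X' Y' Z' : tri_shifted)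
      (f : hom X Y) (g : hom Y Z) (h : hom Z (shift X))
      (f' : hom X' Y') (g' : hom Y' Z') (h' : hom Z' (shift X'))
      (a : hom X X') (b : hom Y Y'),
    dist f g h -> dist f' g' h' -> b \oc f = f' \oc a ->
    exists c : hom Z Z', c \oc g = g' \oc b /\ fmap shift a \oc h = h' \oc c;
  (* TR4, the octahedral axiom *)
  dist_oct : forall (X Y Z X' Y' Z' : tri_shifted)
      (f : hom X Y) (g : hom Y Z)
      (p : hom Y Z') (p' : hom Z' (shift X))
      (q : hom Z X') (q' : hom X' (shift Y))
      (r : hom Z Y') (r' : hom Y' (shift X)),
    dist f p p' -> dist g q q' -> dist (g \oc f) r r' ->
    exists (u : hom Z' Y') (v : hom Y' X'),
      [/\ dist u v (fmap shift p \oc q'),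
          u \oc p = r \oc g, r' \oc u = p', v \oc r = q &
          q' \oc v = fmap shift f \oc r'] }.

Section Silting.
Variable T : triangulated_category.
Local Open Scope classical_set_scope.

(* A full subcategory is given by its set of objects. *)
Definition subcategory (M : set T) : Prop :=
  [/\ forall X Y, isomorphic X Y -> M X -> M Y,
      forall Z, is_zero Z -> M Z,
      forall X Y C (i : hom X C) (j : hom Y C),
        is_coproduct i j -> M X -> M Y -> M C
    & forall X Y C (i : hom X C) (j : hom Y C),
        is_coproduct i j -> M C -> M X].

Definition thick_subcategory (M : set T) : Prop :=
  [/\ subcategory M,
      forall X, M X -> M (shift X),
      forall X, M X -> M (unshift X)
    & forall X Y Z (f : hom X Y) (g : hom Y Z) (h : hom Z (shift X)),
        dist f g h -> M X -> M Y -> M Z].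

Definition thick (M : set T) : set T :=
  \bigcap_(C in [set C | thick_subcategory C /\ M `<=` C]) C.

Definition hom_pos_vanish (M N : set T) : Prop :=
  forall X Y, M X -> N Y ->
  forall i : nat, (0 < i)%N -> forall f : hom X (iter i shift Y), f = 0.

Definition silting (M : set T) : Prop :=
  [/\ subcategory M, hom_pos_vanish M M & thick M = setT].

Definition silt : Type := {M : set T | silting M}.

Definition silt_ge (M N : silt) : Prop := hom_pos_vanish (sval M) (sval N).

End Silting.

(* Main.v *)
Require Import Defs.
From mathcomp Require Import boolp.

Set Implicit Arguments.
Unset Strict Implicit.
Unset Printing Implicit Defensive.

Import GRing.Theory.
Local Open Scope ring_scope.

(** Reflexivity is the vanishing condition in the definition of a silting
    subcategory. For the other two properties, fix a silting subcategory [N]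
    and put
      [P] = [right_pos N], the [X] with Hom(N, X[i]) = 0 for all i > 0,
      [Q] = [left_pos N], the [X] with Hom(X, N[i]) = 0 for all i > 0,
      [U] = [left_perp N], the [X] with Hom(X, P) = 0,
      [V] = [right_perp N], the [Y] with Hom(Q, Y) = 0.
    [U] contains N[-i] and [V] contains N[i] for i > 0, and both are closed
    under extensions because they are orthogonals. Write [A * B] for the class
    of extensions of objects of [B] by objects of [A]. The octahedral axiom
    makes this operation associative, and if Hom(A, B[1]) = 0 then [B * A] is
    contained in [A * B]; hence [A * B] is closed under extensions when [A] and
    [B] are ([ext_closed_star]). Used twice, this shows that [U * (N * V)] is
    closed under extensions. It contains every shift of [N], and the objects
    all of whose shifts lie in it form a triangulated subcategory containing
    [N]. The retracts of the objects of a triangulated subcategory form a thick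
    subcategory ([thick_smd]), so every object of the category is a retract of
    an object of [U * (N * V)] ([decomposition]).

    Let [X] be a retract of [E], with a triangle U0 -> E -> W where [U0] is in
    [U] and [W] in [N * V]. If [X] is in [P], the composite U0 -> E -> X
    vanishes, so [E -> X] factors through [W], and [X] is a retract of [W]
    ([right_pos_smd_coaisle]). Two consequences follow.
    - If moreover [Y] is in [Q], then Hom(Y, N[i]) and Hom(Y, V[i]) vanish for
      i > 0, so Hom(Y, X[i]) = 0 ([pos_vanish_trans]). Applied to the middle
      one of three silting subcategories, this is transitivity.
    - If [X] is also in [Q], take a triangle N0 -> W -> V0 with [N0] in [N] and
      [V0] in [V]. The map [X -> V0] vanishes, so [X -> W] factors through
      [N0], and [X] is a retract, hence a direct summand, of [N0]; thus [X] is
      in [N] ([left_right_pos]). When M >= N >= M this gives that each of the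
      two contains the other, which is antisymmetry. *)

(** * Preadditive categories *)

Section Preadditive.
Variable A : preadditive_category.
Implicit Types X Y Z W : A.

Lemma comp0l X Y Z (f : hom X Y) : (0 : hom Y Z) \oc f = 0.
Proof. by apply: (addIr (0 \oc f)); rewrite -compDl !add0r. Qed.

Lemma comp0r X Y Z (g : hom Y Z) : g \oc (0 : hom X Y) = 0.
Proof. by apply: (addIr (g \oc 0)); rewrite -compDr !add0r. Qed.

Lemma compNl X Y Z (g : hom Y Z) (f : hom X Y) : (- g) \oc f = - (g \oc f).
Proof. by apply: (addIr (g \oc f)); rewrite -compDl !addNr comp0l. Qed.

Lemma compNr X Y Z (g : hom Y Z) (f : hom X Y) : g \oc (- f) = - (g \oc f).
Proof. by apply: (addIr (g \oc f)); rewrite -compDr !addNr comp0r. Qed.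

Lemma compBl X Y Z (g g' : hom Y Z) (f : hom X Y) :
  (g - g') \oc f = g \oc f - g' \oc f.
Proof. by rewrite compDl compNl. Qed.

Lemma compBr X Y Z (g : hom Y Z) (f f' : hom X Y) :
  g \oc (f - f') = g \oc f - g \oc f'.
Proof. by rewrite compDr compNr. Qed.

(** [X] is a retract of [Y]. *)
Definition retract X Y : Prop :=
  exists (s : hom X Y) (r : hom Y X), r \oc s = idm X.

(** Hom(X, Y) = 0. *)
Definition vanish X Y : Prop := forall f : hom X Y, f = 0.

Lemma retract_refl X : retract X X.
Proof. by exists (idm X), (idm X); rewrite comp_idl. Qed.

Lemma retract_trans X Y Z : retract X Y -> retract Y Z -> retract X Z.
Proof.
move=> [s [r rs]] [s' [r' rs']]; exists (s' \oc s), (r \oc r').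
by rewrite -compA (compA r') rs' comp_idl.
Qed.

Lemma iso_id X : is_iso (idm X).
Proof. by exists (idm X); rewrite comp_idl. Qed.

Lemma isomorphic_sym X Y : isomorphic X Y -> isomorphic Y X.
Proof. by move=> [f [g [gf fg]]]; exists g, f. Qed.

Lemma isomorphic_retract X Y : isomorphic X Y -> retract X Y.
Proof. by move=> [f [g [gf fg]]]; exists f, g. Qed.

Lemma vanish_retract_l X Y W : retract X Y -> vanish Y W -> vanish X W.
Proof.
move=> [s [r rs]] v f.
by rewrite -(comp_idr f) -rs compA (v (f \oc r)) comp0l.
Qed.

Lemma vanish_retract_r X Y W : retract X Y -> vanish W Y -> vanish W X.
Proof.
move=> [s [r rs]] v f.
by rewrite -(comp_idl f) -rs -compA (v (s \oc f)) comp0r.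
Qed.

Lemma is_zeroP Z : is_zero Z <-> idm Z = 0.
Proof.
split=> [[h _]|z]; first exact: h.
split=> X f; first by rewrite -(comp_idr f) z comp0r.
by rewrite -(comp_idl f) z comp0l.
Qed.

Lemma is_zero_retract Z X : is_zero Z -> retract Z X.
Proof. by move=> /is_zeroP z; exists 0, 0; rewrite comp0l. Qed.

(** Two coproducts of the same pair of objects are isomorphic. *)
Lemma coproduct_isomorphic X Y C C' (i : hom X C) (j : hom Y C)
    (i' : hom X C') (j' : hom Y C') :
  is_coproduct i j -> is_coproduct i' j' -> isomorphic C C'.
Proof.
move=> cC cC'.
have [a [[ai aj] _]] := cC _ i' j'.
have [b [[bi bj] _]] := cC' _ i j.
exists a, b; split.
- have [c [_ u]] := cC _ i j.
  by apply: etrans (esym (u _ _)) (u _ _); rewrite ?comp_idl // -!compA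
     ?ai ?aj ?bi ?bj.
- have [c [_ u]] := cC' _ i' j'.
  by apply: etrans (esym (u _ _)) (u _ _); rewrite ?comp_idl // -!compA
     ?ai ?aj ?bi ?bj.
Qed.

Lemma coproduct_retract X Y C (i : hom X C) (j : hom Y C) :
  is_coproduct i j -> retract X C.
Proof.
by move=> cC; have [p [[pi _] _]] := cC _ (idm X) 0; exists i, p.
Qed.

End Preadditive.

Section AdditiveFunctor.
Variables (A B : preadditive_category) (F : additive_functor A B).

Lemma fmap0 (X Y : A) : fmap F (0 : hom X Y) = 0.
Proof. by apply: (addIr (fmap F (0 : hom X Y))); rewrite -fmapD !add0r. Qed.

Lemma fmapN (X Y : A) (f : hom X Y) : fmap F (- f) = - fmap F f.
Proof. by apply: (addIr (fmap F f)); rewrite -fmapD !addNr fmap0. Qed.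

Lemma fmap_retract (X Y : A) : retract X Y -> retract (F X) (F Y).
Proof.
by move=> [s [r rs]]; exists (fmap F s), (fmap F r);
  rewrite -fmap_comp rs fmap_id.
Qed.

Lemma fmap_isomorphic (X Y : A) : isomorphic X Y -> isomorphic (F X) (F Y).
Proof.
by move=> [f [g [gf fg]]]; exists (fmap F f), (fmap F g);
  rewrite -!fmap_comp gf fg !fmap_id.
Qed.

Lemma fmap_zero (Z : A) : is_zero Z -> is_zero (F Z).
Proof. by move=> /is_zeroP z; apply/is_zeroP; rewrite -fmap_id z fmap0. Qed.

End AdditiveFunctor.

(** * The shift *)

Section Shift.
Variable T : shifted_category.
Implicit Types X Y Z W : T.

Lemma shift_unshift X : isomorphic (shift (unshift X)) X.
Proof.
by exists (shift_counit T X); exact: (component_iso (shift_counit T) X).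
Qed.

Lemma unshift_shift X : isomorphic X (unshift (shift X)).
Proof. by exists (shift_unit T X); exact: (component_iso (shift_unit T) X). Qed.

Lemma shift_faithful X Y (f g : hom X Y) :
  fmap shift f = fmap shift g -> f = g.
Proof.
move=> e; have [k [kK _]] := component_iso (shift_unit T) Y.
rewrite -[f]comp_idl -[g]comp_idl -kK -!compA; congr (_ \oc _).
have := component_nat (shift_unit T) f.
have := component_nat (shift_unit T) g.
by rewrite /= e => -> ->.
Qed.

Lemma unshift_faithful X Y (f g : hom X Y) :
  fmap unshift f = fmap unshift g -> f = g.
Proof.
move=> e; have [k [_ kK]] := component_iso (shift_counit T) X.
rewrite -[f]comp_idr -[g]comp_idr -kK !compA; congr (_ \oc _).
have := component_nat (shift_counit T) f.
have := component_nat (shift_counit T) g.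
by rewrite /= e => -> ->.
Qed.

(** An equivalence is full: a preimage of [k] is its image under the
    quasi-inverse, conjugated by the unit. *)
Lemma shift_full X Y (k : hom (shift X) (shift Y)) :
  exists f : hom X Y, fmap shift f = k.
Proof.
have [i [iK Ki]] := component_iso (shift_unit T) Y.
have [j [jK Kj]] := component_iso (shift_unit T) X.
exists (i \oc (fmap unshift k \oc shift_unit T X)).
apply: unshift_faithful.
set f := (_ \oc _); have := component_nat (shift_unit T) f; rewrite /= => nf.
rewrite -[LHS]comp_idr -Kj compA -nf /f !compA Ki comp_idl -compA Kj.
exact: comp_idr.
Qed.

Lemma vanish_shift X Y : vanish (shift X) (shift Y) <-> vanish X Y.
Proof.
split=> v f; first by apply: shift_faithful; rewrite fmap0; apply: v.
by have [g <-] := shift_full f; rewrite (v g) fmap0.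
Qed.

Lemma vanish_unshift X Y : vanish (unshift X) Y <-> vanish X (shift Y).
Proof.
rewrite -vanish_shift; split; apply: vanish_retract_l;
  apply: isomorphic_retract; last exact: shift_unshift.
exact/isomorphic_sym/shift_unshift.
Qed.

Lemma vanish_iter_unshift i X Y :
  vanish (iter i unshift X) Y <-> vanish X (iter i shift Y).
Proof.
elim: i Y => [//|i IH] Y.
by rewrite [iter _ unshift X]iterS vanish_unshift IH iterSr.
Qed.

Lemma retract_iter_shift i X Y :
  retract X Y -> retract (iter i shift X) (iter i shift Y).
Proof. by move=> r; elim: i => //= i; apply: fmap_retract. Qed.

End Shift.

(** * Distinguished triangles *)

Section Triangulated.
Variable T : triangulated_category.
Implicit Types X Y Z W : T.
Local Open Scope classical_set_scope.

(** The backward rotation. As [shift (unshift Z)] is only isomorphic to [Z],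
    only the middle map of the new triangle is kept from the original one. *)
Lemma dist_unrot X Y Z (f : hom X Y) (g : hom Y Z) (h : hom Z (shift X)) :
  dist f g h -> exists (e : hom (unshift Z) X) (k : hom Y (shift (unshift Z))),
    dist e f k.
Proof.
move=> d; have [c [c' [cK Kc]]] := isomorphic_sym (shift_unshift Z).
have [e Ee] := shift_full (- (h \oc c')).
exists e, (c \oc g); apply/dist_rot; rewrite Ee opprK.
apply: (dist_iso (iso_id X) (iso_id Y) (c := c) _ _ _ _ d).
- by exists c'.
- by rewrite comp_idl comp_idr.
- by rewrite comp_idr.
- by rewrite fmap_id comp_idl -compA cK comp_idr.
Qed.

Lemma dist_comp0 X Y Z (f : hom X Y) (g : hom Y Z) (h : hom Z (shift X)) :
  dist f g h -> g \oc f = 0.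
Proof.
move=> d; have [O zO] := has_zero T.
have [|c [<- _]] := dist_mor (a := idm X) (b := f) (dist_id X zO) d.
  by [].
exact: comp0r.
Qed.

(** Exactness of Hom(W, -) on a triangle, at its middle object. *)
Lemma dist_lift X Y Z (f : hom X Y) (g : hom Y Z) (h : hom Z (shift X))
    W (a : hom W Y) :
  dist f g h -> g \oc a = 0 -> exists b : hom W X, a = f \oc b.
Proof.
move=> /dist_rot d ga; have [O zO] := has_zero T.
have /dist_rot d' := dist_id W zO.
have [|c [_ e]] := dist_mor (a := a) (b := 0) d' d.
  by rewrite ga comp0l.
have [b Eb] := shift_full c; exists b; apply: shift_faithful.
move: e; rewrite fmap_id compNl compNr comp_idr => /oppr_inj ->.
by rewrite fmap_comp Eb.
Qed.

(** Exactness of Hom(-, W) on a triangle, at its middle object. *)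
Lemma dist_factor X Y Z (f : hom X Y) (g : hom Y Z) (h : hom Z (shift X))
    W (a : hom Y W) :
  dist f g h -> a \oc f = 0 -> exists b : hom Z W, a = b \oc g.
Proof.
move=> d af; have [O zO] := has_zero T.
have [e [k d']] := dist_unrot (dist_id W zO).
have [|c [e' _]] := dist_mor (a := 0) (b := a) d d'.
  by rewrite af comp0r.
by exists c; rewrite e' comp_idl.
Qed.

(** A triangle with zero connecting map splits. *)
Lemma dist_split X Y Z (f : hom X Y) (g : hom Y Z) :
  dist f g (0 : hom Z (shift X)) ->
  exists s : hom Z Y, is_coproduct f s.
Proof.
move=> d.
have [s gs] : exists s, idm Z = g \oc s.
  by apply: dist_lift (proj1 (dist_rot _ _ _) d) _; rewrite comp0l.
(* A left inverse of [f] is obtained from one of its shift, since the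
   shift of [f] is preceded by the zero map in the rotated triangle. *)
have [r rf] : exists r, r \oc f = idm X.
  have [r'' Er] : exists r', idm (shift X) = r' \oc (- fmap shift f).
    by apply: dist_factor (proj1 (dist_rot _ _ _) (proj1 (dist_rot _ _ _) d)) _;
      rewrite comp0r.
  have [r' E] := shift_full r''; exists (- r'); apply: shift_faithful.
  by rewrite fmap_comp fmap_id Er -E compNr fmapN compNl.
have gf := dist_comp0 d.
have [q fq] : exists q, idm Y - s \oc g = f \oc q.
  by apply: dist_lift d _; rewrite compBr compA -gs comp_idl comp_idr subrr.
have sumE : f \oc q + s \oc g = idm Y by rewrite -fq subrK.
have qf : q \oc f = idm X.
  by rewrite -[LHS]comp_idl -rf -compA (compA f) -fq compBl -compA gf comp0r
             subr0 comp_idl.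
have qs : q \oc s = 0.
  by rewrite -[LHS]comp_idl -rf -compA (compA f) -fq compBl -compA -gs
             comp_idl comp_idr subrr comp0r.
exists s => W a b; exists (a \oc q + b \oc g); split.
  by rewrite !compDl -!compA qf qs gf -gs !comp0r !comp_idr addr0 add0r.
move=> c [cf cs].
by rewrite -cf -cs -!compA -compDr sumE comp_idr.
Qed.

(** [tri X Y Z] says that some distinguished triangle has vertices [X], [Y]
    and [Z], in this order. *)
Definition tri X Y Z : Prop :=
  exists (f : hom X Y) (g : hom Y Z) (h : hom Z (shift X)), dist f g h.

Lemma tri_iso X Y Z X' Y' Z' :
  isomorphic X X' -> isomorphic Y Y' -> isomorphic Z Z' ->
  tri X Y Z -> tri X' Y' Z'.
Proof.
move=> [a [a' [aK Ka]]] [b [b' [bK Kb]]] [c [c' [cK Kc]]] [f [g [h d]]].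
exists (b \oc f \oc a'), (c \oc g \oc b'), (fmap shift a \oc h \oc c').
apply: (dist_iso (a := a) (b := b) (c := c) _ _ _ _ _ _ d).
- by exists a'.
- by exists b'.
- by exists c'.
- by rewrite -compA aK comp_idr.
- by rewrite -compA bK comp_idr.
- by rewrite -compA cK comp_idr.
Qed.

Lemma tri_rot X Y Z : tri X Y Z -> tri Y Z (shift X).
Proof.
by move=> [f [g [h /dist_rot d]]]; exists g, h, (- fmap shift f).
Qed.

Lemma tri_unrot X Y Z : tri X Y Z -> tri (unshift Z) X Y.
Proof. by move=> [f [g [h /dist_unrot [e [k d]]]]]; exists e, f, k. Qed.

Lemma tri_shift X Y Z : tri X Y Z -> tri (shift X) (shift Y) (shift Z).
Proof. by do 3 move/tri_rot. Qed.

Lemma tri_unshift X Y Z : tri X Y Z -> tri (unshift X) (unshift Y) (unshift Z).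
Proof. by do 3 move/tri_unrot. Qed.

Lemma tri_iter_shift i X Y Z :
  tri X Y Z -> tri (iter i shift X) (iter i shift Y) (iter i shift Z).
Proof. by move=> t; elim: i => //= i; apply: tri_shift. Qed.

Lemma tri_iter_unshift i X Y Z :
  tri X Y Z -> tri (iter i unshift X) (iter i unshift Y) (iter i unshift Z).
Proof. by move=> t; elim: i => //= i; apply: tri_unshift. Qed.

Lemma tri_zero_r X Z : is_zero Z -> tri X X Z.
Proof. by move=> zZ; exists (idm X), 0, 0; apply: dist_id. Qed.

Lemma tri_zero_l X Z : is_zero Z -> tri (unshift Z) X X.
Proof. by move=> zZ; apply/tri_unrot/tri_zero_r. Qed.

Lemma vanish_tri_r X Y Z W :
  tri X Y Z -> vanish W X -> vanish W Z -> vanish W Y.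
Proof.
move=> [f [g [h d]]] vX vZ a.
by have [b ->] := dist_lift d (vZ (g \oc a)); rewrite (vX b) comp0r.
Qed.

Lemma vanish_tri_l X Y Z W :
  tri X Y Z -> vanish X W -> vanish Z W -> vanish Y W.
Proof.
move=> [f [g [h d]]] vX vZ a.
by have [b ->] := dist_factor d (vX (a \oc f)); rewrite (vZ b) comp0l.
Qed.

Lemma tri_vanish_coproduct X Y Z : tri X Y Z -> vanish Z (shift X) ->
  exists (i : hom X Y) (j : hom Z Y), is_coproduct i j.
Proof.
move=> [f [g [h d]]] v; rewrite (v h) in d.
by have [s cY] := dist_split d; exists f, s.
Qed.

(** A coproduct of [X] and [Y] is obtained as the cone of the zero map
    from Y[-1] to X. *)
Lemma tri_coproduct X Y : exists (C : T) (i : hom X C) (j : hom Y C),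
  is_coproduct i j /\ tri X C Y.
Proof.
have [C [f [g d0]]] := dist_ex (0 : hom (unshift Y) X).
have d := proj1 (dist_rot _ _ _) d0; rewrite fmap0 oppr0 in d.
have [e [e' [eK Ke]]] := shift_unshift Y.
have d' : dist f (e \oc g) (0 : hom Y (shift X)).
  apply: (dist_iso (iso_id X) (iso_id C) (c := e) _ _ _ _ d).
  - by exists e'.
  - by rewrite comp_idl comp_idr.
  - by rewrite comp_idr.
  - by rewrite comp0r comp0l.
have [s cC] := dist_split d'; exists C, f, s; split=> //.
by exists f, (e \oc g), 0.
Qed.

(** In a triangulated category a retract is a direct summand. *)
Lemma retract_coproduct X C : retract X C ->
  exists (Y : T) (i : hom X C) (j : hom Y C), is_coproduct i j.
Proof.
move=> [s [r rs]]; have [Y [g [h d]]] := dist_ex s.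
have sh : fmap shift s \oc h = 0.
  have := dist_comp0 (proj1 (dist_rot _ _ _) (proj1 (dist_rot _ _ _) d)).
  by rewrite compNl => /eqP; rewrite oppr_eq0 => /eqP.
have h0 : h = 0.
  by rewrite -(comp_idl h) -fmap_id -rs fmap_comp -compA sh comp0r.
rewrite h0 in d; have [j cC] := dist_split d.
by exists Y, s, j.
Qed.

(** If [X] and [Y] are retracts of [A] and [B], then the cone of a map
    [X -> Y] is a retract of the cone of the composite [A -> X -> Y -> B]. *)
Lemma tri_retract_cone X Y Z (A B : T) (f : hom X Y) (g : hom Y Z)
    (h : hom Z (shift X)) :
  dist f g h -> retract X A -> retract Y B ->
  exists C, tri A B C /\ retract Z C.
Proof.
move=> d [s [r rs]] [s' [r' rs']].
have [C [g' [h' d']]] := dist_ex (s' \oc f \oc r).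
exists C; split; first by exists (s' \oc f \oc r), g', h'.
have [|u [ug uh]] := dist_mor (a := s) (b := s') d d'.
  by rewrite -compA rs comp_idr.
have [|v [vg vh]] := dist_mor (a := r) (b := r') d' d.
  by rewrite !compA rs' comp_idl.
pose n := v \oc u - idm Z.
have ng : n \oc g = 0.
  by rewrite compBl -compA ug compA vg -compA rs' comp_idl comp_idr subrr.
have hn : h \oc n = 0.
  by rewrite compBr compA -vh -compA -uh compA -fmap_comp rs fmap_id comp_idl
             comp_idr subrr.
have [k nk] := dist_factor (proj1 (dist_rot _ _ _) d) ng.
have nn : n \oc n = 0 by rewrite {1}nk -compA hn comp0r.
(* As [v \oc u] is [1 + n] with [n] of square zero, its inverse is [1 - n]. *)
exists u, ((idm Z - n) \oc v); rewrite -compA.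
have -> : v \oc u = idm Z + n by rewrite /n addrC subrK.
by rewrite compBl comp_idl compDr comp_idr nn addr0 addrK.
Qed.

End Triangulated.

(** * Classes of extensions *)

Section Star.
Variable T : triangulated_category.
Implicit Types X Y Z W : T.
Implicit Types A B C D : set T.
Local Open Scope classical_set_scope.

(** The class, written [A * B] in comments, of extensions of objects of [B] by objects of [A]. *)
Definition star A B : set T :=
  [set Y | exists X Z, [/\ tri X Y Z, A X & B Z]].

Definition ext_closed A : Prop :=
  forall X Y Z, tri X Y Z -> A X -> A Z -> A Y.

(** The closure of a class under retracts. *)
Definition smd A : set T := [set X | exists2 Y, A Y & retract X Y].

Lemma star_iso A B X Y : isomorphic X Y -> star A B X -> star A B Y.
Proof.
move=> e [Z [W [t AZ BW]]]; exists Z, W; split=> //.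
by apply: tri_iso e _ t; exists (idm _); apply: iso_id.
Qed.

Lemma subset_star A A' B B' :
  A `<=` A' -> B `<=` B' -> star A B `<=` star A' B'.
Proof.
by move=> sA sB X [Y [Z [t AY BZ]]]; exists Y, Z; split; [|apply: sA|apply: sB].
Qed.

Lemma subset_star_l A B : (forall Z, is_zero Z -> B Z) -> A `<=` star A B.
Proof.
move=> B0 X AX; have [Z zZ] := has_zero T.
by exists X, Z; split; [apply: tri_zero_r | | apply: B0].
Qed.

Lemma subset_star_r A B : (forall Z, is_zero Z -> A Z) -> B `<=` star A B.
Proof.
move=> A0 X BX; have [Z zZ] := has_zero T.
by exists (unshift Z), X; split; [apply: tri_zero_l | apply/A0/fmap_zero | ].
Qed.

Lemma starA_subset A B C : star (star A B) C `<=` star A (star B C).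
Proof.
move=> W [Y [V [[g [q [q' dg]]] [X [Z [[f [p [p' df]]] AX BZ]]] CV]]].
have [P [r [r' d]]] := dist_ex (g \oc f).
have [u [v [dP _ _ _ _]]] := dist_oct df dg d.
exists X, P; split=> //; first by exists (g \oc f), r, r'.
by exists Z, V; split=> //; exists u, v, (fmap shift p \oc q').
Qed.

Lemma starA_supset A B C : star A (star B C) `<=` star (star A B) C.
Proof.
move=> W [X [P [tW AX [Z [V [tP BZ CV]]]]]].
have [g [p [p' dg]]] := tri_rot tW.
have [f [q [q' df]]] := tri_rot tP.
have [Q [r [r' d]]] := dist_ex (f \oc g).
have [u [v [dQ _ _ _ _]]] := dist_oct dg df d.
have tQ : tri (unshift (shift X)) (unshift Q) (unshift (shift Z)).
  by apply: tri_unshift; exists u, v, (fmap shift p \oc q').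
exists (unshift Q), V; split=> //.
  by apply: tri_unrot; exists (f \oc g), r, r'.
exists X, Z; split=> //; apply: tri_iso tQ.
- exact/isomorphic_sym/unshift_shift.
- by exists (idm _); apply: iso_id.
- exact/isomorphic_sym/unshift_shift.
Qed.

Lemma star_swap A B :
  (forall X Y, A X -> B Y -> vanish X (shift Y)) -> star B A `<=` star A B.
Proof.
move=> v Y [X [Z [t BX AZ]]].
have [i [j cY]] := tri_vanish_coproduct t (v _ _ AZ BX).
have [C [i' [j' [cC tC]]]] := tri_coproduct Z X.
have cC' : is_coproduct j' i'.
  move=> W a b; have [h [[hi hj] u]] := cC W b a.
  by exists h; split=> // h' [e e']; apply: u.
apply: (star_iso (X := C)); last by exists Z, X.
exact: coproduct_isomorphic cC' cY.
Qed.

Lemma star_idem A : ext_closed A -> star A A `<=` A.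
Proof. by move=> eA Y [X [Z [t AX AZ]]]; apply: eA t AX AZ. Qed.

(** [(A * B) * (A * B) = A * (B * A) * B], and [B * A] is contained in
    [A * B] when the extensions of [A] by [B] split. *)
Lemma ext_closed_star A B :
  ext_closed A -> ext_closed B ->
  (forall X Y, A X -> B Y -> vanish X (shift Y)) -> ext_closed (star A B).
Proof.
move=> eA eB v X Y Z t AX AZ.
have : star (star A B) (star A B) Y by exists X, Z.
move=> /starA_subset.
have sB : star B (star A B) `<=` star A B.
  move=> W /starA_supset /(subset_star (star_swap v) (fun _ x => x)).
  move=> /starA_subset.
  exact: subset_star (fun _ x => x) (star_idem eB) W.
move=> /(subset_star (fun _ x => x) sB) /starA_supset.
exact: subset_star (star_idem eA) (fun _ x => x) Y.
Qed.

Lemma smd_retract A X Y : retract X Y -> smd A Y -> smd A X.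
Proof. by move=> r [Z AZ r']; exists Z => //; apply: retract_trans r r'. Qed.

(** The retracts of the objects of a triangulated subcategory form a thick
    subcategory. *)
Lemma thick_smd D :
  D !=set0 -> (forall X, D X -> D (shift X)) ->
  (forall X, D X -> D (unshift X)) -> ext_closed D ->
  thick_subcategory (smd D).
Proof.
move=> [X0 DX0] Ds Du De.
have sS X : smd D X -> smd D (shift X).
  by move=> [Y DY r]; exists (shift Y); [apply: Ds | apply: fmap_retract].
have sU X : smd D X -> smd D (unshift X).
  by move=> [Y DY r]; exists (unshift Y); [apply: Du | apply: fmap_retract].
have sC X Y Z : tri X Y Z -> smd D X -> smd D Y -> smd D Z.
  move=> [f [g [h d]]] [A DA rA] [B DB rB].
  have [C [tC rC]] := tri_retract_cone d rA rB.
  by exists C => //; apply: De (tri_rot tC) DB (Ds _ DA).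
have sE : ext_closed (smd D).
  by move=> X Y Z t sX sZ; apply: sC (tri_unrot t) (sU _ sZ) sX.
split=> //; last by move=> X Y Z f g h d; apply: sC; exists f, g, h.
split.
- move=> X Y /isomorphic_sym/isomorphic_retract; exact: smd_retract.
- by move=> Z zZ; exists X0 => //; apply: is_zero_retract.
- move=> X Y C i j cC sX sY.
  have [C' [i' [j' [cC' tC']]]] := tri_coproduct X Y.
  apply: smd_retract (sE _ _ _ tC' sX sY).
  exact/isomorphic_retract/(coproduct_isomorphic cC cC').
- by move=> X Y C i j /coproduct_retract; apply: smd_retract.
Qed.

End Star.

(** * The decomposition given by a silting subcategory *)

Section SiltingDecomposition.
Variables (T : triangulated_category) (N : set T).
Hypothesis siltN : silting N.
Implicit Types X Y Z W : T.
Local Open Scope classical_set_scope.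

(** Hom(X, Y[i]) = 0 for all i > 0. *)
Definition pos_vanish X Y : Prop :=
  forall i : nat, (0 < i)%N -> vanish X (iter i shift Y).

(** The objects [X] with Hom(N, X[i]) = 0 for all i > 0. *)
Definition right_pos : set T := [set X | forall Y, N Y -> pos_vanish Y X].

(** The objects [X] with Hom(X, N[i]) = 0 for all i > 0. *)
Definition left_pos : set T := [set X | forall Y, N Y -> pos_vanish X Y].

(** The left orthogonal of [right_pos]. It plays the role of the extension
    closure of the negative shifts of [N]. *)
Definition left_perp : set T :=
  [set X | forall Y, right_pos Y -> vanish X Y].

(** The right orthogonal of [left_pos]. It plays the role of the extension
    closure of the positive shifts of [N]. *)
Definition right_perp : set T :=
  [set Y | forall X, left_pos X -> vanish X Y].

Lemma silting_right_pos X : N X -> right_pos X.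
Proof. by case: siltN => _ v _ NX Y NY i i0; apply: v. Qed.

Lemma silting_left_pos X : N X -> left_pos X.
Proof. by case: siltN => _ v _ NX Y NY i i0; apply: v. Qed.

Lemma right_pos_shift X : right_pos X -> right_pos (shift X).
Proof. by move=> PX Y NY i i0; rewrite -iterSr; apply: PX. Qed.

Lemma ext_closed_right_pos : ext_closed right_pos.
Proof.
move=> X Y Z t PX PZ W NW i i0.
by apply: vanish_tri_r (tri_iter_shift i t) (PX _ NW _ i0) (PZ _ NW _ i0).
Qed.

Lemma left_pos_unshift X : left_pos X -> left_pos (unshift X).
Proof. by move=> QX Y NY i i0; apply/vanish_unshift/(QX _ NY i.+1). Qed.

Lemma right_perp_iter_shift i X : right_perp X -> right_perp (iter i shift X).
Proof.
move=> VX; elim: i => //= i IH Y QY.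
by apply/vanish_unshift/IH/left_pos_unshift.
Qed.

Lemma ext_closed_left_perp : ext_closed left_perp.
Proof.
by move=> X Y Z t UX UZ W PW; apply: vanish_tri_l t (UX _ PW) (UZ _ PW).
Qed.

Lemma ext_closed_right_perp : ext_closed right_perp.
Proof.
by move=> X Y Z t VX VZ W QW; apply: vanish_tri_r t (VX _ QW) (VZ _ QW).
Qed.

Lemma right_perp_zero Z : is_zero Z -> right_perp Z.
Proof. by move=> [_ zZ] X _ f. Qed.

Lemma left_perp_zero Z : is_zero Z -> left_perp Z.
Proof. by move=> [zZ _] X _ f. Qed.

Lemma ext_closed_silting : ext_closed N.
Proof.
case: siltN => [[_ _ NC _] v _] X Y Z t NX NZ.
have [i [j cY]] := tri_vanish_coproduct t (v _ _ NZ NX 1%N isT).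
exact: NC cY NX NZ.
Qed.

Lemma right_perp_right_pos : right_perp `<=` right_pos.
Proof.
move=> X VX Y NY i i0; apply: right_perp_iter_shift VX _ _.
exact: silting_left_pos.
Qed.

(** The extensions of objects of [right_perp] by objects of [N]. The retracts
    of these objects are exactly the objects of [right_pos]. *)
Definition coaisle : set T := star N right_perp.

Lemma coaisle_right_pos : coaisle `<=` right_pos.
Proof.
move=> X [Y [Z [t NY VZ]]]; apply: ext_closed_right_pos t _ _.
  exact: silting_right_pos.
exact: right_perp_right_pos.
Qed.

Lemma ext_closed_coaisle : ext_closed coaisle.
Proof.
apply: ext_closed_star ext_closed_silting ext_closed_right_perp _.
by move=> X Y NX /right_perp_right_pos PY; apply: (PY _ NX 1%N).
Qed.

Lemma ext_closed_decomposition : ext_closed (star left_perp coaisle).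
Proof.
apply: ext_closed_star ext_closed_left_perp ext_closed_coaisle _.
by move=> X Y UX /coaisle_right_pos /right_pos_shift; apply: UX.
Qed.

Lemma decomposition_iter_shift i X :
  N X -> star left_perp coaisle (iter i shift X).
Proof.
case: siltN => [[_ N0 _ _] _ _] NX.
apply: subset_star_r left_perp_zero _ _; case: i => [|i].
  exact: subset_star_l right_perp_zero _ NX.
by apply: subset_star_r N0 _ _ => Y QY; apply: QY.
Qed.

Lemma decomposition_iter_unshift i X :
  N X -> star left_perp coaisle (iter i unshift X).
Proof.
case: siltN => [[_ N0 _ _] _ _] NX; case: i => [|i].
  exact: (decomposition_iter_shift 0).
apply: subset_star_l.
  by move=> Z zZ; apply: subset_star_r N0 _ _; apply: right_perp_zero.
by move=> Y PY; apply/vanish_iter_unshift/PY.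
Qed.

(** Every object is a retract of some [E] with a triangle U -> E -> W, where
    [U] is in [left_perp] and [W] in [coaisle]. *)
Lemma decomposition X : smd (star left_perp coaisle) X.
Proof.
set E := star left_perp coaisle.
(* Membership of all shifts, and not only of the object itself, makes [D]
   closed under the shift in both directions. *)
pose D : set T :=
  [set Y | forall i, E (iter i shift Y) /\ E (iter i unshift Y)].
have sND : N `<=` D.
  move=> Y NY i; split; first exact: decomposition_iter_shift.
  exact: decomposition_iter_unshift.
have iterI F i Y Z :
    isomorphic Y Z -> isomorphic (iter i (fob F) Y) (iter i (fob F) Z).
  by move=> e; elim: i => //= i; apply: fmap_isomorphic.
suff [Y DY r] : smd D X by exists Y => //; case: (DY 0).
case: siltN => [[_ N0 _ _] _ gen].
have : thick N X by rewrite gen.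
apply; split; last by move=> Y /sND DY; exists Y => //; apply: retract_refl.
apply: thick_smd.
- by have [Z zZ] := has_zero T; exists Z; apply/sND/N0.
- move=> Y DY i; split; first by rewrite -iterSr; apply: (DY i.+1).1.
  case: i => [|i]; first exact: (DY 1%N).1.
  rewrite iterSr; apply: star_iso (DY i).2.
  by apply: iterI; apply: unshift_shift.
- move=> Y DY i; split; last by rewrite -iterSr; apply: (DY i.+1).2.
  case: i => [|i]; first exact: (DY 1%N).2.
  rewrite iterSr; apply: star_iso (DY i).1.
  by apply: iterI; apply/isomorphic_sym/shift_unshift.
- move=> Y Z W t DY DW i; split.
    exact: ext_closed_decomposition (tri_iter_shift i t) (DY i).1 (DW i).1.
  exact: ext_closed_decomposition (tri_iter_unshift i t) (DY i).2 (DW i).2.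
Qed.

Lemma right_pos_smd_coaisle X : right_pos X -> smd coaisle X.
Proof.
move=> PX; have [Y [U [W [[f [g [h d]]] UU aW]]] [s [r rs]]] := decomposition X.
have [r' rE] := dist_factor d (UU _ PX (r \oc f)).
by exists W => //; exists (g \oc s), r'; rewrite compA -rE.
Qed.

(** [X] is a retract of an object of [N * V]; as [X] maps trivially to [V],
    it is a direct summand of an object of [N]. *)
Lemma left_right_pos X : left_pos X -> right_pos X -> N X.
Proof.
move=> QX /right_pos_smd_coaisle [W [Y [Z [[f [g [h d]]] NY VZ]]] [s [r rs]]].
have [s' sE] := dist_lift d (VZ _ QX (g \oc s)).
have rX : retract X Y by exists s', (r \oc f); rewrite -compA -sE.
have [X' [i [j cY]]] := retract_coproduct rX.
by case: siltN => [[_ _ _ NS] _ _]; apply: NS cY NY.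
Qed.

Lemma pos_vanish_trans X Y : left_pos X -> right_pos Y -> pos_vanish X Y.
Proof.
move=> QX /right_pos_smd_coaisle [W [A [B [t NA VB]]] r] i i0.
apply: vanish_retract_r (retract_iter_shift i r) _.
apply: vanish_tri_r (tri_iter_shift i t) (QX _ NA _ i0) _.
exact: right_perp_iter_shift VB _ QX.
Qed.

End SiltingDecomposition.

Theorem theorem2p11 (T : triangulated_category) :
  Relation_Definitions.order (silt T) (@silt_ge T).
Proof.
split.
- by move=> [M [sM vM gM]].
- move=> [L sL] [M sM] [N sN] /= LM MN X Z LX NZ.
  apply: (pos_vanish_trans sM) => Y MY i i0; first exact: LM.
  exact: MN.
- move=> [M sM] [N sN] /= MN NM; apply: eq_exist => /=.
  apply/seteqP; split=> X HX.
  + apply: (left_right_pos sN) => Y NY i i0; first exact: MN.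
    exact: NM.
  + apply: (left_right_pos sM) => Y NY i i0; first exact: NM.
    exact: MN.
Qed.
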